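(* Let $R$ be a field and let $\mathcal{G}$ be an ultragraph. Consider the ultragraph Leavitt path algebra $L_R(\mathcal{G})$ of $\mathcal{G}$. Then the following five assertions are equivalent: (i) $\mathcal{G}$ is finite and acyclic; (ii) $L_R(\mathcal{G})$ is left artinian; (iii) $L_R(\mathcal{G})$ is right artinian; (iv) $L_R(\mathcal{G})$ is artinian; (v) $L_R(\mathcal{G})$ is unital and semisimple.
   Context: **Ultragraphs.** An ultragraph $\mathcal{G}=(G^0,\mathcal{G}^1,r,s)$ consists of two countable sets $G^0$ (vertices) and $\mathcal{G}^1$ (edges), a map $s:\mathcal{G}^1\to G^0$ and a map $r:\mathcal{G}^1\to P(G^0)\setminus\{\emptyset\}$, where $P(G^0)$ is the power set. $\mathcal{G}^0$ denotes the smallest subset of $P(G^0)$ that contains $\{v\}$ for all $v\in G^0$, contains $r(e)$ for all $e\in\mathcal{G}^1$, and is closed under finite unions and non-empty finite intersections (so all elements of $\mathcal{G}^0$ are non-empty). $\mathcal{G}$ is finite if $G^0$ and $\mathcal{G}^1$ are finite. A cycle is a sequence of edges $e_1\dots e_n$, $n\ge1$, with $s(e_{i+1})\in r(e_i)$ for $1\le i\le n-1$ and $s(e_1)\in r(e_n)$; $\mathcal{G}$ is acyclic if it has no cycles. **Leavitt path algebra.** $L_R(\mathcal{G})$ is the universal (associative, not necessarily unital) $R$-algebra with generators $\{s_e,s_e^*:e\in\mathcal{G}^1\}\cup\{p_A:A\in\mathcal{G}^0\}$ and relations: (1) $p_\emptyset=0$ (convention for empty intersections), $p_Ap_B=p_{A\cap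 B}$, $p_{A\cup B}=p_A+p_B-p_{A\cap B}$ for $A,B\in\mathcal{G}^0$; (2) $p_{s(e)}s_e=s_ep_{r(e)}=s_e$ and $p_{r(e)}s_e^*=s_e^*p_{s(e)}=s_e^*$ for $e\in\mathcal{G}^1$; (3) $s_e^*s_f=\delta_{e,f}\,p_{r(e)}$ for $e,f\in\mathcal{G}^1$; (4) $p_v=\sum_{s(e)=v}s_es_e^*$ whenever $0<|s^{-1}(v)|<\infty$, where $p_v=p_{\{v\}}$. **Chain conditions.** A (not necessarily unital) ring is left (right) artinian if it satisfies the descending chain condition on left (right) ideals, and artinian if it is both left and right artinian. A unital ring is semisimple if it is semisimple as a left module over itself. *)

(* Defs.v *)
From HB Require Import structures.
From mathcomp Require Import all_boot all_order all_algebra generic_quotient.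
From mathcomp Require Import boolp classical_sets cardinality.

Set Implicit Arguments.
Unset Strict Implicit.
Unset Printing Implicit Defensive.

Import GRing.Theory.
Local Open Scope classical_set_scope.
Local Open Scope ring_scope.
Local Open Scope quotient_scope.

Reserved Notation "x ** y" (at level 40, left associativity).

HB.mixin Record Zmodule_isNonUnitalRing A of GRing.Zmodule A := {
  numul : A -> A -> A;
  numulA : associative numul;
  numulDl : left_distributive numul +%R;
  numulDr : right_distributive numul +%R
}.

#[short(type="nonUnitalRingType")]
HB.structure Definition NonUnitalRing :=
  {A of Zmodule_isNonUnitalRing A & GRing.Zmodule A}.

Notation "x ** y" := (numul x y) : ring_scope.

HB.mixin Record NonUnitalRing_isNonUnitalAlgebra (R : comPzRingType) A
    of NonUnitalRing A & GRing.Lmodule R A := {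
  nuscalerAl : forall (k : R) (x y : A), k *: (x ** y) = (k *: x) ** y;
  nuscalerAr : forall (k : R) (x y : A), k *: (x ** y) = x ** (k *: y)
}.

#[short(type="nonUnitalAlgType")]
HB.structure Definition NonUnitalAlgebra (R : comPzRingType) :=
  {A of NonUnitalRing_isNonUnitalAlgebra R A & NonUnitalRing A
      & GRing.Lmodule R A}.

Definition nonunital_alg_hom (R : comPzRingType) (A B : nonUnitalAlgType R)
    (h : A -> B) : Prop :=
  linear h /\ {morph h : x y / x ** y}.

Section RingTheory.
Variable A : nonUnitalRingType.
Implicit Types I M : set A.

(* Over a ring without unit, ideals need not be stable under external
   scalars: they are additive subgroups stable under multiplication by the
   elements of A. *)
Definition left_ideal I : Prop :=
  [/\ I 0, (forall x y, I x -> I y -> I (x - y))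
    & forall a x, I x -> I (a ** x)].

Definition right_ideal I : Prop :=
  [/\ I 0, (forall x y, I x -> I y -> I (x - y))
    & forall a x, I x -> I (x ** a)].

Definition dcc (P : set A -> Prop) : Prop :=
  forall I : nat -> set A, (forall n, P (I n)) ->
    (forall n, I n.+1 `<=` I n) ->
    exists N, forall n, (N <= n)%N -> I n = I N.

Definition left_artinian : Prop := dcc left_ideal.
Definition right_artinian : Prop := dcc right_ideal.
Definition artinian : Prop := left_artinian /\ right_artinian.

(* The zero ring is unital, with unit 0. *)
Definition unital : Prop := exists u : A, forall x, u ** x = x /\ x ** u = x.

(* When A is unital, its left ideals are the submodules of A seen as a left
   module over itself. *)
Definition simple_left_ideal M : Prop :=
  [/\ left_ideal M, M <> [set 0]
    & forall I, left_ideal I -> I `<=` M -> I = [set 0] \/ I = M].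

Definition ideal_sum (S : set (set A)) : set A :=
  [set x | exists2 s : seq A,
     (forall y, y \in s -> exists2 M, S M & M y) & x = \sum_(y <- s) y].

(* A is the direct sum of a family of simple left ideals. Distinct members of
   such a family are distinct as sets, whence the indexing by a set of ideals;
   the sum of the empty family is 0. *)
Definition left_semisimple : Prop :=
  exists S : set (set A),
    [/\ forall M, S M -> simple_left_ideal M,
        forall M, S M -> M `&` ideal_sum (S `\ M) = [set 0]
      & ideal_sum S = setT].

Definition unital_semisimple : Prop := unital /\ left_semisimple.

End RingTheory.

Inductive term (R X : Type) : Type :=
| TVar of X
| TZero
| TOpp of term R X
| TAdd of term R X & term R X
| TScale of R & term R X
| TMul of term R X & term R X.

Arguments TVar {R X}.
Arguments TZero {R X}.

Definition tsum (R X : Type) (s : seq (term R X)) : term R X :=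
  foldr (@TAdd R X) TZero s.

HB.instance Definition _ (R X : Type) := gen_eqMixin (term R X).
HB.instance Definition _ (R X : Type) := gen_choiceMixin (term R X).

Section Presentation.
Variables (R : comPzRingType) (X : Type).
Variable rels : term R X -> term R X -> Prop.

(* The smallest congruence that contains the relations and the axioms of
   non-unital R-algebras. *)
Inductive tcongr : term R X -> term R X -> Prop :=
| tc_rel t u : rels t u -> tcongr t u
| tc_refl t : tcongr t t
| tc_sym t u : tcongr t u -> tcongr u t
| tc_trans t u v : tcongr t u -> tcongr u v -> tcongr t v
| tc_opp t t' : tcongr t t' -> tcongr (TOpp t) (TOpp t')
| tc_add t t' u u' :
    tcongr t t' -> tcongr u u' -> tcongr (TAdd t u) (TAdd t' u')
| tc_scale k t t' : tcongr t t' -> tcongr (TScale k t) (TScale k t')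
| tc_mul t t' u u' :
    tcongr t t' -> tcongr u u' -> tcongr (TMul t u) (TMul t' u')
| tc_addA t u v : tcongr (TAdd t (TAdd u v)) (TAdd (TAdd t u) v)
| tc_addC t u : tcongr (TAdd t u) (TAdd u t)
| tc_add0 t : tcongr (TAdd TZero t) t
| tc_addN t : tcongr (TAdd (TOpp t) t) TZero
| tc_scaleA k l t : tcongr (TScale k (TScale l t)) (TScale (k * l) t)
| tc_scale1 t : tcongr (TScale 1 t) t
| tc_scaleDr k t u :
    tcongr (TScale k (TAdd t u)) (TAdd (TScale k t) (TScale k u))
| tc_scaleDl k l t :
    tcongr (TScale (k + l) t) (TAdd (TScale k t) (TScale l t))
| tc_mulA t u v : tcongr (TMul t (TMul u v)) (TMul (TMul t u) v)
| tc_mulDl t u v : tcongr (TMul (TAdd t u) v) (TAdd (TMul t v) (TMul u v))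
| tc_mulDr t u v : tcongr (TMul t (TAdd u v)) (TAdd (TMul t u) (TMul t v))
| tc_scaleAl k t u : tcongr (TScale k (TMul t u)) (TMul (TScale k t) u)
| tc_scaleAr k t u : tcongr (TScale k (TMul t u)) (TMul t (TScale k u)).

Definition tcongrb : rel (term R X) := fun t u => `[< tcongr t u >].

Lemma tcongrb_refl : reflexive tcongrb.
Proof. by move=> t; apply/asboolP; apply: tc_refl. Qed.

Lemma tcongrb_sym : symmetric tcongrb.
Proof. by move=> t u; apply/asboolP/asboolP; apply: tc_sym. Qed.

Lemma tcongrb_trans : transitive tcongrb.
Proof.
by move=> u t v /asboolP tu /asboolP uv; apply/asboolP; apply: tc_trans uv.
Qed.

Canonical tcongr_equiv :=
  EquivRel tcongrb tcongrb_refl tcongrb_sym tcongrb_trans.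

Definition presented : Type := {eq_quot tcongr_equiv}.

HB.instance Definition _ := Choice.on presented.

Definition pclass (t : term R X) : presented := \pi_{eq_quot tcongr_equiv} t.
Definition prepr (x : presented) : term R X :=
  repr (x : {eq_quot tcongr_equiv}).

Definition pgen (x : X) : presented := pclass (TVar x).

Lemma preprK : cancel prepr pclass.
Proof. exact: reprK. Qed.

Lemma pclassP t u : pclass t = pclass u <-> tcongr t u.
Proof. by split=> [/eqmodP/asboolP|tu] //; apply/eqmodP/asboolP. Qed.

Lemma prepr_congr t : tcongr (prepr (pclass t)) t.
Proof. by apply/pclassP; rewrite preprK. Qed.

Definition pzero : presented := pclass TZero.
Definition popp (x : presented) : presented := pclass (TOpp (prepr x)).
Definition padd (x y : presented) : presented :=
  pclass (TAdd (prepr x) (prepr y)).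
Definition pscale (k : R) (x : presented) : presented :=
  pclass (TScale k (prepr x)).
Definition pmul (x y : presented) : presented :=
  pclass (TMul (prepr x) (prepr y)).

Lemma poppE t : popp (pclass t) = pclass (TOpp t).
Proof. by apply/pclassP; apply: tc_opp; apply: prepr_congr. Qed.

Lemma paddE t u : padd (pclass t) (pclass u) = pclass (TAdd t u).
Proof. by apply/pclassP; apply: tc_add; apply: prepr_congr. Qed.

Lemma pscaleE k t : pscale k (pclass t) = pclass (TScale k t).
Proof. by apply/pclassP; apply: tc_scale; apply: prepr_congr. Qed.

Lemma pmulE t u : pmul (pclass t) (pclass u) = pclass (TMul t u).
Proof. by apply/pclassP; apply: tc_mul; apply: prepr_congr. Qed.

Let pE := (poppE, paddE, pscaleE, pmulE).

Lemma presented_ind (P : presented -> Prop) :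
  (forall t, P (pclass t)) -> forall x, P x.
Proof. by move=> Pt x; rewrite -(preprK x). Qed.

Lemma paddA : associative padd.
Proof.
elim/presented_ind=> t; elim/presented_ind=> u; elim/presented_ind=> v.
by rewrite !pE; apply/pclassP/tc_addA.
Qed.

Lemma paddC : commutative padd.
Proof.
elim/presented_ind=> t; elim/presented_ind=> u.
by rewrite !pE; apply/pclassP/tc_addC.
Qed.

Lemma padd0 : left_id pzero padd.
Proof. by elim/presented_ind=> t; rewrite !pE; apply/pclassP/tc_add0. Qed.

Lemma paddN : left_inverse pzero popp padd.
Proof. by elim/presented_ind=> t; rewrite !pE; apply/pclassP/tc_addN. Qed.

HB.instance Definition _ :=
  GRing.isZmodule.Build presented paddA paddC padd0 paddN.

Lemma pscaleA k l (x : presented) : pscale k (pscale l x) = pscale (k * l) x.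
Proof.
by elim/presented_ind: x => t; rewrite !pE; apply/pclassP/tc_scaleA.
Qed.

Lemma pscale1 : left_id 1 pscale.
Proof. by elim/presented_ind=> t; rewrite !pE; apply/pclassP/tc_scale1. Qed.

Lemma pscaleDr : right_distributive pscale +%R.
Proof.
move=> k; elim/presented_ind=> t; elim/presented_ind=> u.
by rewrite /GRing.add /= !pE; apply/pclassP/tc_scaleDr.
Qed.

Lemma pscaleDl (x : presented) : {morph pscale^~ x : k l / k + l}.
Proof.
elim/presented_ind: x => t k l.
by rewrite [RHS]/GRing.add /= !pE; apply/pclassP/tc_scaleDl.
Qed.

HB.instance Definition _ :=
  GRing.Zmodule_isLmodule.Build R presented
    pscaleA pscale1 pscaleDr pscaleDl.

Lemma pmulA : associative pmul.
Proof.
elim/presented_ind=> t; elim/presented_ind=> u; elim/presented_ind=> v.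
by rewrite !pE; apply/pclassP/tc_mulA.
Qed.

Lemma pmulDl : left_distributive pmul +%R.
Proof.
elim/presented_ind=> t; elim/presented_ind=> u; elim/presented_ind=> v.
by rewrite /GRing.add /= !pE; apply/pclassP/tc_mulDl.
Qed.

Lemma pmulDr : right_distributive pmul +%R.
Proof.
elim/presented_ind=> t; elim/presented_ind=> u; elim/presented_ind=> v.
by rewrite /GRing.add /= !pE; apply/pclassP/tc_mulDr.
Qed.

HB.instance Definition _ :=
  Zmodule_isNonUnitalRing.Build presented pmulA pmulDl pmulDr.

Lemma pscaleAl k (x y : presented) : k *: (x ** y) = (k *: x) ** y.
Proof.
elim/presented_ind: x => t; elim/presented_ind: y => u.
by rewrite /numul /GRing.scale /= !pE; apply/pclassP/tc_scaleAl.
Qed.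

Lemma pscaleAr k (x y : presented) : k *: (x ** y) = x ** (k *: y).
Proof.
elim/presented_ind: x => t; elim/presented_ind: y => u.
by rewrite /numul /GRing.scale /= !pE; apply/pclassP/tc_scaleAr.
Qed.

HB.instance Definition _ :=
  NonUnitalRing_isNonUnitalAlgebra.Build R presented pscaleAl pscaleAr.

Lemma pclassD t u : pclass t + pclass u = pclass (TAdd t u).
Proof. exact: paddE. Qed.

Lemma pclassN t : - pclass t = pclass (TOpp t).
Proof. exact: poppE. Qed.

Lemma pclassZ k t : k *: pclass t = pclass (TScale k t).
Proof. exact: pscaleE. Qed.

Lemma pclassM t u : pclass t ** pclass u = pclass (TMul t u).
Proof. exact: pmulE. Qed.

Fixpoint teval (B : nonUnitalAlgType R) (f : X -> B) (t : term R X) : B :=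
  match t with
  | TVar x => f x
  | TZero => 0
  | TOpp t => - teval f t
  | TAdd t u => teval f t + teval f u
  | TScale k t => k *: teval f t
  | TMul t u => teval f t ** teval f u
  end.

Lemma pclass_teval t : pclass t = teval pgen t.
Proof.
elim: t => //= [t <-|t <- u <-|k t <-|t <- u <-].
- by rewrite pclassN.
- by rewrite pclassD.
- by rewrite pclassZ.
- by rewrite pclassM.
Qed.

Lemma presented_rels t u : rels t u -> teval pgen t = teval pgen u.
Proof. by move=> tu; rewrite -!pclass_teval; apply/pclassP/tc_rel. Qed.

Lemma presented_universal (B : nonUnitalAlgType R) (f : X -> B) :
  (forall t u, rels t u -> teval f t = teval f u) ->
  exists! h : presented -> B, nonunital_alg_hom h /\ forall x, h (pgen x) = f x.
Proof.
move=> frels.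
have evalP t u : tcongr t u -> teval f t = teval f u.
  elim=> {t u} /=.
  - exact: frels.
  - by [].
  - by move=> t u _ ->.
  - by move=> t u v _ -> _ ->.
  - by move=> t u _ ->.
  - by move=> t u v w _ -> _ ->.
  - by move=> k t u _ ->.
  - by move=> t u v w _ -> _ ->.
  - by move=> *; rewrite addrA.
  - by move=> *; rewrite addrC.
  - by move=> *; rewrite add0r.
  - by move=> *; rewrite addNr.
  - by move=> *; rewrite scalerA.
  - by move=> *; rewrite scale1r.
  - by move=> *; rewrite scalerDr.
  - by move=> *; rewrite scalerDl.
  - by move=> *; rewrite numulA.
  - by move=> *; rewrite numulDl.
  - by move=> *; rewrite numulDr.
  - by move=> *; rewrite nuscalerAl.
  - by move=> *; rewrite nuscalerAr.
pose h (x : presented) := teval f (prepr x).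
have hE t : h (pclass t) = teval f t by exact/evalP/prepr_congr.
exists h; split=> [|g [[glin gmul] gf]].
  split=> [|x]; last by rewrite hE.
  split=> [k x y|x y]; elim/presented_ind: x => t; elim/presented_ind: y => u.
    by rewrite pclassZ pclassD !hE.
  by rewrite pclassM !hE.
have gD x y : g (x + y) = g x + g y.
  by have := glin 1 x y; rewrite !scale1r.
have g0 : g 0 = 0 by apply: (addrI (g 0)); rewrite -gD !addr0.
have gZ k x : g (k *: x) = k *: g x.
  by have := glin k x 0; rewrite g0 !addr0.
have gN x : g (- x) = - g x.
  by apply: (addrI (g x)); rewrite -gD !subrr.
apply/funext; elim/presented_ind=> t; rewrite hE.
elim: t => /= [x||t ->|t -> u ->|k t ->|t -> u ->].
- by rewrite gf.
- by rewrite g0.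
- by rewrite -gN pclassN.
- by rewrite -gD pclassD.
- by rewrite -gZ pclassZ.
- by rewrite -gmul pclassM.
Qed.

End Presentation.

Record ultragraph : Type := Ultragraph {
  vertex : countType;
  edge : countType;
  usource : edge -> vertex;
  urange : edge -> set vertex;
  urange_neq0 : forall e, urange e !=set0
}.

Section Ultragraph.
Variable G : ultragraph.

(* Binary operations suffice: the partial intersections of a nonempty finite
   intersection are nonempty. *)
Inductive gen_vertex : set (vertex G) -> Prop :=
| gv_vertex v : gen_vertex [set v]
| gv_range e : gen_vertex (@urange G e)
| gv_union A B : gen_vertex A -> gen_vertex B -> gen_vertex (A `|` B)
| gv_inter A B : gen_vertex A -> gen_vertex B -> A `&` B !=set0 ->
    gen_vertex (A `&` B).

Lemma gen_vertex_neq0 A : gen_vertex A -> A !=set0.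
Proof.
elim=> {A} // [v|e|A B _ [x Ax] _ _]; first by exists v.
- exact: urange_neq0.
- by exists x; left.
Qed.

Definition finite_ultragraph : Prop :=
  finite_set [set: vertex G] /\ finite_set [set: edge G].

Definition acyclic_ultragraph : Prop :=
  forall c : seq (edge G), c != [::] ->
    ~~ cycle [rel e f | usource f \in urange e] c.

End Ultragraph.

Inductive leavitt_gen (G : ultragraph) : Type :=
| GenS of edge G
| GenSstar of edge G
| GenP (A : set (vertex G)) of gen_vertex A.

Section Leavitt.
Variables (R : comPzRingType) (G : ultragraph).
Notation tm := (term R (leavitt_gen G)).

Definition tS (e : edge G) : tm := TVar (GenS e).
Definition tSstar (e : edge G) : tm := TVar (GenSstar e).
(* The value 0 is only used at the empty set, for A `&` B with A and B
   disjoint. *)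
Definition tP (A : set (vertex G)) : tm :=
  if pselect (gen_vertex A) is left gA then TVar (GenP gA) else TZero.

Inductive leavitt_rel : tm -> tm -> Prop :=
| lr_mulP A B : gen_vertex A -> gen_vertex B ->
    leavitt_rel (TMul (tP A) (tP B)) (tP (A `&` B))
| lr_unionP A B : gen_vertex A -> gen_vertex B ->
    leavitt_rel (tP (A `|` B))
      (TAdd (TAdd (tP A) (tP B)) (TOpp (tP (A `&` B))))
| lr_sourceS e : leavitt_rel (TMul (tP [set usource e]) (tS e)) (tS e)
| lr_Srange e : leavitt_rel (TMul (tS e) (tP (urange e))) (tS e)
| lr_rangeSstar e :
    leavitt_rel (TMul (tP (urange e)) (tSstar e)) (tSstar e)
| lr_Sstarsource e :
    leavitt_rel (TMul (tSstar e) (tP [set usource e])) (tSstar e)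
| lr_SstarS e f :
    leavitt_rel (TMul (tSstar e) (tS f))
      (if e == f then tP (urange e) else TZero)
(* es enumerates the finite nonempty set of the edges with source v *)
| lr_CK v (es : seq (edge G)) : es != [::] -> uniq es ->
    (forall e, (e \in es) = (usource e == v)) ->
    leavitt_rel (tP [set v]) (tsum [seq TMul (tS e) (tSstar e) | e <- es]).

Definition leavitt : nonUnitalAlgType R := presented leavitt_rel.

End Leavitt.

(* Main.v *)
Require Import Defs.
From HB Require Import structures.
From mathcomp Require Import all_boot all_order all_algebra.
From mathcomp Require Import boolp classical_sets cardinality functions.

(** Write L for the Leavitt path algebra of the ultragraph G. Three facts give
    all the equivalences.

    If G is finite and acyclic, then L is unital and equal to its left socle,
    the sum of its simple left ideals; hence L is semisimple
    ([finite_acyclic_unital_semisimple]). The unit is p_V for the set V of all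
    vertices, and the socle is a two-sided ideal, so that it is enough to have
    all the p_v in the socle. If no edge leaves v, then L p_v is simple or zero
    ([sink_socle]). If some edge leaves v, then p_v is the sum of the
    s_e p_r(e) s_e^* over the edges e leaving v, and one concludes by induction
    along the edges, which is well founded because G is finite and acyclic.

    A unital semisimple ring is a sum of finitely many simple left ideals,
    because its unit is, and such a sum satisfies the descending chain condition
    on left ideals ([unital_semisimple_left_artinian]).

    If L is left artinian, then G is finite and acyclic. Here L acts on the
    functions on pairs of a maximal path and an integer. If w_0, w_1, ... are
    vectors and t_n in L kills w_i for all i < n, but not w_n, then the
    annihilators of {w_0, ..., w_(n-1)} are a strictly descending chain of left
    ideals ([not_left_artinian]). Distinct vertices v_n give such a system with
    t_n = p_(v_n), and distinct edges e_n give one with t_n = s_(e_n)^*. For a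
    cycle c = e_1 ... e_n based at v, the system is an infinite Jordan block:
    s_c acts on functions supported on the periodic path c c c ... as a shift of
    the integer by n, so that t_k = (s_c - p_v)^k iterates a difference operator
    on functions on Z, and the iterated primitives w_k of the constant 1 form
    the required sequence.

    Left and right are exchanged by the involution of L that swaps s_e and
    s_e^* ([leavitt_involution]). *)

Set Implicit Arguments.
Unset Strict Implicit.
Unset Printing Implicit Defensive.

Import GRing.Theory.
Local Open Scope classical_set_scope.
Local Open Scope ring_scope.

(** * Left ideals of rings without unit *)

Section NonUnitalRing.
Variable A : nonUnitalRingType.
Implicit Types (x y a b : A) (I J M : set A) (S : set (set A)).

Lemma numul0 x : x ** 0 = 0.
Proof. by apply: (addrI (x ** 0)); rewrite -numulDr !addr0. Qed.

Lemma num0ul x : 0 ** x = 0.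
Proof. by apply: (addrI (0 ** x)); rewrite -numulDl !addr0. Qed.

Lemma numulNr x y : x ** (- y) = - (x ** y).
Proof. by apply: (addrI (x ** y)); rewrite -numulDr !subrr numul0. Qed.

Lemma numulNl x y : (- x) ** y = - (x ** y).
Proof. by apply: (addrI (x ** y)); rewrite -numulDl !subrr num0ul. Qed.

Lemma numul_sumr (T : Type) x (s : seq T) (f : T -> A) :
  x ** (\sum_(i <- s) f i) = \sum_(i <- s) x ** f i.
Proof.
by apply: (big_morph (numul x)); [move=> y z; rewrite numulDr|rewrite numul0].
Qed.

Lemma numul_suml (T : Type) x (s : seq T) (f : T -> A) :
  (\sum_(i <- s) f i) ** x = \sum_(i <- s) f i ** x.
Proof.
by apply: (big_morph (numul^~ x)); [move=> y z; rewrite numulDl|rewrite num0ul].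
Qed.

Lemma left_ideal0 I : left_ideal I -> I 0. Proof. by case. Qed.

Lemma left_idealB I x y : left_ideal I -> I x -> I y -> I (x - y).
Proof. by case=> _ + _; apply. Qed.

Lemma left_idealM I a x : left_ideal I -> I x -> I (a ** x).
Proof. by case=> _ _; apply. Qed.

Lemma left_idealN I x : left_ideal I -> I x -> I (- x).
Proof. by move=> iI Ix; rewrite -sub0r; apply: left_idealB => //; case: iI. Qed.

Lemma left_idealD I x y : left_ideal I -> I x -> I y -> I (x + y).
Proof.
move=> iI Ix Iy; rewrite -[y]opprK.
by apply: left_idealB => //; exact: left_idealN.
Qed.

Lemma left_ideal_sum I (T : eqType) (s : seq T) (f : T -> A) :
  left_ideal I -> (forall i, i \in s -> I (f i)) -> I (\sum_(i <- s) f i).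
Proof.
move=> iI If; rewrite big_seq; apply: (big_ind I) => //.
  exact: left_ideal0.
by move=> x y; apply: left_idealD.
Qed.

Lemma left_ideal_set0 : left_ideal [set (0 : A)].
Proof.
by split=> [//|x y -> ->|a x ->]; rewrite /= ?subr0 // numul0.
Qed.

Lemma left_ideal_setI I J :
  left_ideal I -> left_ideal J -> left_ideal (I `&` J).
Proof.
move=> iI iJ; split=> [|x y [Ix Jx] [Iy Jy]|a x [Ix Jx]].
- by split; exact: left_ideal0.
- by split; exact: left_idealB.
- by split; exact: left_idealM.
Qed.

Lemma left_ideal_neq0 I :
  left_ideal I -> I <> [set 0] -> exists2 x, I x & x <> 0.
Proof.
move=> iI I0; apply: contrapT => noI; apply: I0; apply/seteqP; split.
  by move=> x Ix; apply: contrapT => x0; apply: noI; exists x.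
by move=> _ ->; exact: left_ideal0.
Qed.

Definition add_ideal I J : set A := [set x | exists2 y, I y & J (x - y)].

Lemma add_ideal_subl I J : left_ideal J -> I `<=` add_ideal I J.
Proof.
by move=> iJ x Ix; exists x => //; rewrite subrr; exact: left_ideal0.
Qed.

Lemma add_ideal_subr I J : left_ideal I -> J `<=` add_ideal I J.
Proof. by move=> iI x Jx; exists 0; rewrite ?subr0 //; exact: left_ideal0. Qed.

Lemma left_ideal_add I J :
  left_ideal I -> left_ideal J -> left_ideal (add_ideal I J).
Proof.
move=> iI iJ; split=> [|x x' [y Iy Jxy] [y' Iy' Jxy']|a x [y Iy Jxy]].
- by apply: add_ideal_subl => //; exact: left_ideal0.
- exists (y - y'); first exact: left_idealB.
  have -> : x - x' - (y - y') = x - y - (x' - y').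
    by rewrite !opprD !opprK addrACA.
  exact: left_idealB.
- exists (a ** y); first exact: left_idealM.
  by rewrite -numulNr -numulDr; exact: left_idealM.
Qed.

Lemma ideal_sum_left_ideal S :
  (forall M, S M -> left_ideal M) -> left_ideal (ideal_sum S).
Proof.
move=> iS; split=> [|_ _ [s sS ->] [t tS ->]|a _ [s sS ->]].
- by exists [::] => //; rewrite big_nil.
- exists (s ++ map -%R t); last by rewrite big_cat big_map sumrN.
  move=> y; rewrite mem_cat => /orP[/sS //|/mapP[z /tS[M SM Mz] ->]].
  by exists M => //; apply: left_idealN => //; exact: iS.
- exists (map (numul a) s); last by rewrite big_map numul_sumr.
  move=> _ /mapP[z /sS[M SM Mz] ->].
  by exists M => //; apply: left_idealM => //; exact: iS.
Qed.

Lemma ideal_sum_sub S I :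
  left_ideal I -> (forall M, S M -> M `<=` I) -> ideal_sum S `<=` I.
Proof.
move=> iI SI _ [s sS ->]; apply: left_ideal_sum => // y /sS[M SM].
exact: SI.
Qed.

Lemma sub_ideal_sum S M : S M -> M `<=` ideal_sum S.
Proof.
move=> SM x Mx; exists [:: x]; last by rewrite big_seq1.
by move=> y; rewrite inE => /eqP->; exists M.
Qed.

Lemma ideal_sumS S S' : S `<=` S' -> ideal_sum S `<=` ideal_sum S'.
Proof.
by move=> SS' x [s sS ->]; exists s => // y /sS[M /SS' ? ?]; exists M.
Qed.

Lemma ideal_sumU1 S M : (forall N, S N -> left_ideal N) -> left_ideal M ->
  ideal_sum (M |` S) = add_ideal M (ideal_sum S).
Proof.
move=> iS iM; have iSS := ideal_sum_left_ideal iS.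
apply/seteqP; split.
  apply: ideal_sum_sub; first exact: left_ideal_add.
  move=> N [->|SN]; first exact: add_ideal_subl.
  by apply: subset_trans (sub_ideal_sum SN) _; exact: add_ideal_subr.
move=> x [y My Sxy]; rewrite -[x](subrK y).
have iMS : left_ideal (ideal_sum (M |` S)).
  by apply: ideal_sum_left_ideal => N [->//|]; exact: iS.
apply: left_idealD => //; first by apply: ideal_sumS Sxy => N; right.
by apply: (@sub_ideal_sum _ M) => //; left.
Qed.

(** * The left socle and finite sums of simple left ideals *)

Definition socle : set A := ideal_sum (@simple_left_ideal A).

Lemma socle_left_ideal : left_ideal socle.
Proof. by apply: ideal_sum_left_ideal => M []. Qed.

(** Right multiplication by b is a morphism of left modules, so Schur's lemma
    applies. *)
Lemma simple_left_ideal_mulr M b : simple_left_ideal M ->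
  (exists2 m, M m & m ** b <> 0) -> simple_left_ideal [set m ** b | m in M].
Proof.
move=> [iM M0 Msimple] [m0 Mm0 m0b].
have iMb : left_ideal [set m ** b | m in M].
  split=> [|_ _ [x Mx <-] [y My <-]|a _ [x Mx <-]].
  - by exists 0; [exact: left_ideal0|rewrite num0ul].
  - exists (x - y); first exact: left_idealB.
    by rewrite numulDl numulNl.
  - by exists (a ** x); [exact: left_idealM|rewrite numulA].
split=> // [Mb0|I iI IMb].
  have : [set m ** b | m in M] (m0 ** b) by exists m0.
  by rewrite Mb0.
have iJ : left_ideal (M `&` [set m | I (m ** b)]).
  apply: left_ideal_setI => //; split=> [|x y /= Ix Iy|a x /= Ix].
  - by rewrite /= num0ul; exact: left_ideal0.
  - by rewrite numulDl numulNl; exact: left_idealB.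
  - by rewrite -numulA; exact: left_idealM.
have [J0|JM] := Msimple _ iJ (@subIsetl _ _ _).
  left; apply/seteqP; split=> [x Ix|_ ->]; last exact: left_ideal0.
  have [m Mm mx] := IMb _ Ix.
  suff -> : x = 0 by [].
  have : (M `&` [set m | I (m ** b)]) m by split; rewrite //= mx.
  by rewrite J0 => m0E; rewrite -mx m0E num0ul.
right; apply/seteqP; split=> // _ [m Mm <-].
by move: Mm; rewrite -JM => -[].
Qed.

Lemma socle_mulr x b : socle x -> socle (x ** b).
Proof.
case=> s sS ->; rewrite numul_suml.
have iA := socle_left_ideal.
apply: left_ideal_sum => // y /sS[M Ms My].
have [->|yb] := pselect (y ** b = 0).
  exact: left_ideal0.
have sMb : simple_left_ideal [set m ** b | m in M].
  by apply: simple_left_ideal_mulr => //; exists y.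
by apply: (sub_ideal_sum sMb); exists y.
Qed.

Inductive simple_sum : set A -> Prop :=
| simple_sum0 : simple_sum [set 0]
| simple_sumS M I :
    simple_left_ideal M -> simple_sum I -> simple_sum (add_ideal M I).

Lemma simple_sum_left_ideal I : simple_sum I -> left_ideal I.
Proof.
elim=> [|M J [iM _ _] _ iJ]; first exact: left_ideal_set0.
exact: left_ideal_add.
Qed.

Lemma socle_simple_sum x : socle x -> exists2 I, simple_sum I & I x.
Proof.
case=> s sS ->; elim: s sS => [|y s IHs] sS.
  by exists [set 0]; [exact: simple_sum0|rewrite big_nil].
have [|I sI Is] := IHs; first by move=> z zs; apply: sS; rewrite inE zs orbT.
have [M sM My] := sS y (mem_head _ _).
exists (add_ideal M I); first exact: simple_sumS.
by exists y => //; rewrite big_cons addrC addKr.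
Qed.

Lemma simple_sumT : unital A -> socle = setT -> simple_sum setT.
Proof.
move=> [u u1] socT.
have [|I sI Iu] := @socle_simple_sum u; first by rewrite socT.
suff <- : I = setT by [].
apply/seteqP; split=> // x _; rewrite -[x](u1 x).2.
by apply: left_idealM Iu; exact: simple_sum_left_ideal.
Qed.

(** By induction on the number of simple summands. In M + L, the traces on L of
    the chain stabilize. If no I n is contained in L, then I n + L = M + L for
    all n, because M is simple, and then I n is determined by its trace on L. *)
Lemma simple_sum_dcc L : simple_sum L ->
  forall I : nat -> set A, (forall n, left_ideal (I n)) ->
    (forall n, I n.+1 `<=` I n) -> I 0%N `<=` L ->
    exists N, forall n, (N <= n)%N -> I n = I N.
Proof.
elim=> {L} [|M L sM sL IHL] I iI Idec IL.
  exists 0%N => n _; apply/seteqP; split=> x; elim: n => //= n IHn.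
    by move=> /Idec /IHn.
  by move=> /IL ->; exact: left_ideal0.
have anti m n : (m <= n)%N -> I n `<=` I m.
  elim: n => [|n IHn]; first by rewrite leqn0 => /eqP->.
  rewrite leq_eqVlt => /predU1P[->//|/IHn In x /Idec]; exact: In.
have iL := simple_sum_left_ideal sL.
have [||x [_]//|N IN] := IHL (fun n => I n `&` L).
- by move=> n; exact: left_ideal_setI.
- by move=> n x [/Idec].
have [[k IkL]|noL] := pselect (exists k, I k `<=` L).
  exists (maxn N k) => n; rewrite geq_max => /andP[Nn kn].
  have ILE m : (k <= m)%N -> I m = I m `&` L.
    by move=> km; apply/esym/setIidPl; apply: subset_trans (anti _ _ km) IkL.
  by rewrite ILE // [RHS]ILE ?leq_maxr // IN // [RHS]IN // leq_maxl.
exists N => n Nn; apply/seteqP; split; first exact: anti.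
move=> x INx.
have [y Iny Ly] : exists2 y, I n y & ~ L y.
  apply: contrapT => noy; apply: noL; exists n => y Iny.
  by apply: contrapT => Ly; apply: noy; exists y.
(* M lies in I n + L: the part of M in this sum is a nonzero subideal of M. *)
have [iM _ Msimple] := sM.
have ME : M `&` add_ideal (I n) L = M.
  have [||K0|//] := Msimple (M `&` add_ideal (I n) L).
  - by apply: left_ideal_setI => //; exact: left_ideal_add.
  - exact: subIsetl.
  have [m Mm Lym] := IL y (anti _ _ (leq0n n) _ Iny).
  have : (M `&` add_ideal (I n) L) m.
    by split=> //; exists y => //; rewrite -opprB; exact: left_idealN.
  by rewrite K0 => m0; case: Ly; rewrite m0 subr0 in Lym.
have [m Mm Lxm] := IL x (anti _ _ (leq0n N) _ INx).
have [z Inz Lmz] : add_ideal (I n) L m by move: Mm; rewrite -{1}ME => -[].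
have Lxz : L (x - z) by rewrite -(subrK m x) -addrA; exact: left_idealD.
rewrite -(subrK z x); apply: left_idealD => //.
have : (I N `&` L) (x - z).
  by split=> //; apply: left_idealB => //; exact: anti Inz.
by rewrite -(IN n Nn) => -[].
Qed.

(** Summands are added one at a time: a simple left ideal either meets the sum
    of the previous ones in 0 or is contained in it. *)
Lemma simple_sum_direct L : simple_sum L ->
  exists S : set (set A), [/\ forall M, S M -> simple_left_ideal M,
    forall M, S M -> M `&` ideal_sum (S `\ M) = [set 0] & ideal_sum S = L].
Proof.
elim=> {L} [|M L sM sL [S [Ssimple Sdirect SL]]].
  exists set0; split=> //; apply/seteqP; split=> [|_ ->].
    by apply: ideal_sum_sub => //; exact: left_ideal_set0.
  by apply: left_ideal0; exact: ideal_sum_left_ideal.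
have iS N : S N -> left_ideal N by move/Ssimple => -[].
have [iM _ Msimple] := sM; have iL := simple_sum_left_ideal sL.
have [||ML0|MLM] := Msimple (M `&` L).
- exact: left_ideal_setI.
- exact: subIsetl.
- exists (M |` S); split; last by rewrite ideal_sumU1 // SL.
    by move=> N [->//|]; exact: Ssimple.
  have SM : ~ S M.
    move=> SM; have [_ M0 _] := sM; apply: M0; rewrite -ML0.
    by apply/esym/setIidPl; rewrite -SL; exact: sub_ideal_sum.
  have D0 N : left_ideal N -> left_ideal (ideal_sum ((M |` S) `\ N)) ->
      (forall x, N x -> ideal_sum ((M |` S) `\ N) x -> x = 0) ->
      N `&` ideal_sum ((M |` S) `\ N) = [set 0].
    move=> iN iMS H; apply/seteqP; split=> [x [Nx Sx]|_ ->]; first exact: H.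
    by split; exact: left_ideal0.
  move=> N MSN; have iMS : left_ideal (ideal_sum ((M |` S) `\ N)).
    by apply: ideal_sum_left_ideal => K [[->|/iS]].
  have iN : left_ideal N by case: MSN => [->|/iS].
  apply: D0 => // x Nx.
  case: MSN => [NM|SN].
    have -> : (M |` S) `\ N = S.
      rewrite NM; apply/seteqP; split=> [K [[//|]]//|K SK].
      by split; [right|move=> KM; apply: SM; rewrite -KM].
    rewrite SL => Lx.
    have : (M `&` L) x by split; rewrite // -NM.
    by rewrite ML0.
  have -> : (M |` S) `\ N = M |` (S `\ N).
    apply/seteqP; split=> [K [[->|SK] KN]|K [->|[SK KN]]].
    - by left.
    - by right.
    - by split; [left|move=> MN; apply: SM; rewrite MN].
    - by split; [right|].
  rewrite ideal_sumU1 //; last by move=> K [/iS].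
  case=> m Mm Sxm.
  have Lm : (M `&` L) m.
    split=> //; rewrite -SL -[m](subKr x).
    have iSS := ideal_sum_left_ideal iS.
    apply: left_idealB => //; first exact: (sub_ideal_sum SN).
    by apply: ideal_sumS Sxm => K [].
  move: Lm Sxm; rewrite ML0 => -> ; rewrite subr0 => Sx.
  have : (N `&` ideal_sum (S `\ N)) x by [].
  by rewrite Sdirect.
- exists S; split=> //; rewrite SL.
  apply/seteqP; split; first exact: add_ideal_subr.
  move=> x [m Mm Lxm]; rewrite -(subrK m x); apply: left_idealD => //.
  by move: Mm; rewrite -MLM => -[].
Qed.

Lemma unital_semisimpleE : unital_semisimple A <-> unital A /\ socle = setT.
Proof.
split=> [[uA [S [Ssimple _ ST]]]|[uA socT]]; split=> //.
  by apply/seteqP; split=> // x; rewrite -ST; apply: ideal_sumS.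
exact: simple_sum_direct (simple_sumT uA socT).
Qed.

Lemma unital_semisimple_left_artinian : unital_semisimple A -> left_artinian A.
Proof.
move/unital_semisimpleE => [uA socT] I iI Idec.
exact: (simple_sum_dcc (simple_sumT uA socT)) iI Idec _.
Qed.

End NonUnitalRing.

(** * Anti-involutions and opposite algebras *)

Section AntiInvolution.
Variables (A : nonUnitalRingType) (h : A -> A).
Hypotheses (hB : {morph h : x y / x - y})
  (hM : forall x y, h (x ** y) = h y ** h x) (hK : involutive h).

Let h0 : h 0 = 0. Proof. by rewrite -[X in h X](subrr 0) hB subrr. Qed.

Lemma left_ideal_preim (I : set A) : right_ideal I -> left_ideal (h @^-1` I).
Proof.
case=> I0 IB IM; split=> [|x y Ix Iy|a x Ix]; rewrite /preimage /=.
- by rewrite h0.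
- by rewrite hB; exact: IB.
- by rewrite hM; exact: IM.
Qed.

Lemma right_ideal_preim (I : set A) : left_ideal I -> right_ideal (h @^-1` I).
Proof.
case=> I0 IB IM; split=> [|x y Ix Iy|a x Ix]; rewrite /preimage /=.
- by rewrite h0.
- by rewrite hB; exact: IB.
- by rewrite hM; exact: IM.
Qed.

Lemma dcc_preim (P Q : set A -> Prop) :
  (forall I, Q I -> P (h @^-1` I)) -> dcc P -> dcc Q.
Proof.
move=> QP dccP I QI Idec.
have preK (J : set A) : h @^-1` (h @^-1` J) = J.
  by apply/funext => x; rewrite /preimage /= hK.
have [||N IN] := dccP (fun n => h @^-1` I n).
- by move=> n; exact: QP.
- by move=> n x; exact: Idec.
- by exists N => n /IN /(congr1 (preimage h)); rewrite !preK.
Qed.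

Lemma anti_involution_artinian : left_artinian A <-> right_artinian A.
Proof.
split; apply: dcc_preim => I; first exact: left_ideal_preim.
exact: right_ideal_preim.
Qed.

End AntiInvolution.

Definition opposite (A : Type) : Type := A.

Section Opposite.
Variables (R : comPzRingType) (A : nonUnitalAlgType R).

HB.instance Definition _ := GRing.Lmodule.on (opposite A).

Definition opposite_mul (x y : opposite A) : opposite A := (y : A) ** (x : A).

Lemma opposite_mulA : associative opposite_mul.
Proof. by move=> x y z; rewrite /opposite_mul numulA. Qed.

Lemma opposite_mulDl : left_distributive opposite_mul +%R.
Proof. by move=> x y z; rewrite /opposite_mul -numulDr. Qed.

Lemma opposite_mulDr : right_distributive opposite_mul +%R.
Proof. by move=> x y z; rewrite /opposite_mul -numulDl. Qed.

HB.instance Definition _ := Zmodule_isNonUnitalRing.Build (opposite A)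
  opposite_mulA opposite_mulDl opposite_mulDr.

Lemma opposite_scaleAl k (x y : opposite A) :
  k *: opposite_mul x y = opposite_mul (k *: x) y.
Proof. exact: (@nuscalerAr R A k y x). Qed.

Lemma opposite_scaleAr k (x y : opposite A) :
  k *: opposite_mul x y = opposite_mul x (k *: y).
Proof. exact: (@nuscalerAl R A k y x). Qed.

HB.instance Definition _ := NonUnitalRing_isNonUnitalAlgebra.Build R
  (opposite A) opposite_scaleAl opposite_scaleAr.

End Opposite.

(** * Relations and involution of the Leavitt path algebra *)

Lemma presented_closed (R : comPzRingType) (X : Type)
    (rels : term R X -> term R X -> Prop) (P : presented rels -> Prop) :
  P 0 -> (forall x y, P x -> P y -> P (x + y)) ->
  (forall k x, P x -> P (k *: x)) -> (forall x y, P x -> P y -> P (x ** y)) ->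
  (forall g, P (pgen rels g)) -> forall x, P x.
Proof.
move=> P0 PD PZ PM Pg; elim/presented_ind.
elim=> [g||t Pt|t Pt u Pu|k t Pt|t Pt u Pu].
- exact: Pg.
- exact: P0.
- by rewrite -pclassN -scaleN1r; exact: PZ.
- by rewrite -pclassD; exact: PD.
- by rewrite -pclassZ; exact: PZ.
- by rewrite -pclassM; exact: PM.
Qed.

Section LeavittRelations.
Variables (R : comPzRingType) (G : ultragraph).
Notation L := (leavitt R G).

Definition lS (e : edge G) : L := pclass _ (tS R e).
Definition lSstar (e : edge G) : L := pclass _ (tSstar R e).
Definition lP (A : set (vertex G)) : L := pclass _ (tP R A).

Lemma lP_gen A (gA : gen_vertex A) : pgen _ (GenP gA) = lP A.
Proof.
rewrite /lP /tP; case: pselect => // gA'.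
by rewrite (Prop_irrelevance gA gA').
Qed.

Lemma lP0 : lP set0 = 0.
Proof.
by rewrite /lP /tP; case: pselect => // g0; have [] := gen_vertex_neq0 g0.
Qed.

Lemma leavitt_closed (P : L -> Prop) :
  P 0 -> (forall x y, P x -> P y -> P (x + y)) ->
  (forall k x, P x -> P (k *: x)) -> (forall x y, P x -> P y -> P (x ** y)) ->
  (forall e, P (lS e)) -> (forall e, P (lSstar e)) ->
  (forall A, gen_vertex A -> P (lP A)) -> forall x, P x.
Proof.
move=> P0 PD PZ PM PS PSs PP; apply: presented_closed => // -[e|e|A gA].
- exact: PS.
- exact: PSs.
- by rewrite lP_gen; exact: PP.
Qed.

Lemma lPM A B : gen_vertex A -> gen_vertex B -> lP A ** lP B = lP (A `&` B).
Proof. by move=> gA gB; rewrite pclassM; apply/pclassP/tc_rel/lr_mulP. Qed.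

Lemma lPU A B : gen_vertex A -> gen_vertex B ->
  lP (A `|` B) = lP A + lP B - lP A ** lP B.
Proof.
move=> gA gB; rewrite lPM // [lP A + _]pclassD [- _]pclassN pclassD.
exact/pclassP/tc_rel/lr_unionP.
Qed.

Lemma lsourceS e : lP [set usource e] ** lS e = lS e.
Proof. by rewrite pclassM; apply/pclassP/tc_rel/lr_sourceS. Qed.

Lemma lSrange e : lS e ** lP (@urange G e) = lS e.
Proof. by rewrite pclassM; apply/pclassP/tc_rel/lr_Srange. Qed.

Lemma lrangeSstar e : lP (@urange G e) ** lSstar e = lSstar e.
Proof. by rewrite pclassM; apply/pclassP/tc_rel/lr_rangeSstar. Qed.

Lemma lSstarsource e : lSstar e ** lP [set usource e] = lSstar e.
Proof. by rewrite pclassM; apply/pclassP/tc_rel/lr_Sstarsource. Qed.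

Lemma lSstarS e f :
  lSstar e ** lS f = if e == f then lP (@urange G e) else 0.
Proof.
have -> : (if e == f then lP (@urange G e) else 0) =
    pclass _ (if e == f then tP R (@urange G e) else TZero) by case: ifP.
by rewrite pclassM; apply/pclassP/tc_rel/lr_SstarS.
Qed.

Lemma lCK v (es : seq (edge G)) : es != [::] -> uniq es ->
    (forall e, (e \in es) = (usource e == v)) ->
  lP [set v] = \sum_(e <- es) lS e ** lSstar e.
Proof.
move=> es0 ues esE.
have -> : lP [set v] =
    pclass _ (tsum [seq TMul (tS R e) (tSstar R e) | e <- es]).
  exact/pclassP/tc_rel/lr_CK.
elim: es {es0 ues esE} => [|e es IHes]; first by rewrite big_nil.
by rewrite big_cons /= -pclassD IHes -pclassM.
Qed.

(** Exchanging the generators attached to an edge reverses the relations, so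
    it extends to a morphism from L to its opposite algebra. *)
Lemma leavitt_involution : exists h : L -> L, [/\ {morph h : x y / x - y},
  forall x y, h (x ** y) = h y ** h x & involutive h].
Proof.
pose f g : opposite L := match g with
  | GenS e => lSstar e | GenSstar e => lS e | @GenP _ A _ => lP A end.
have fP A : teval f (tP R A) = lP A.
  rewrite /tP; case: pselect => // nA.
  by rewrite /lP /tP; case: pselect.
have fmul (x y : opposite L) : x ** y = (y : L) ** (x : L) by [].
have [t u|h [[[hlin hM] hg] _]] :=
    @presented_universal R _ (@leavitt_rel R G) (opposite L) f.
  case=> {t u} [A B gA gB|A B gA gB|e|e|e|e|e e'|v es es0 ues esE] /=.
  - by rewrite !fP fmul lPM // setIC.
  - by rewrite !fP -[_ (lP A) _]/(_ + _) lPU // lPM.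
  - by rewrite fP fmul lSstarsource.
  - by rewrite fP fmul lrangeSstar.
  - by rewrite fP fmul lSrange.
  - by rewrite fP fmul lsourceS.
  - rewrite fmul lSstarS eq_sym; case: eqP => [->|_] //=; by rewrite fP.
  - rewrite fP (lCK es0 ues esE).
    elim: es {es0 ues esE} => [|e es IHes]; first by rewrite big_nil.
    by rewrite big_cons /= IHes.
have hD x y : h (x + y) = h x + h y by have := hlin 1 x y; rewrite !scale1r.
have h0 : h 0 = 0 by apply: (addrI (h 0)); rewrite -hD !addr0.
have hZ k x : h (k *: x) = k *: h x by have := hlin k x 0; rewrite h0 !addr0.
exists h; split=> [x y|x y|].
- by rewrite hD -scaleN1r hZ scaleN1r.
- exact: hM.
have hS e : h (lS e) = lSstar e by exact: hg (GenS e).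
have hSs e : h (lSstar e) = lS e by exact: hg (GenSstar e).
apply: leavitt_closed => [|x y hx hy|k x hx|x y hx hy|e|e|A gA].
- by rewrite !h0.
- by rewrite !hD hx hy.
- by rewrite !hZ hx.
- by rewrite hM fmul hM fmul hx hy.
- by rewrite hS hSs.
- by rewrite hSs hS.
- have hP : h (lP A) = lP A by rewrite -{1}(lP_gen gA) hg.
  by rewrite !hP.
Qed.

Lemma leavitt_left_right_artinian : left_artinian L <-> right_artinian L.
Proof.
have [h [hB hM hK]] := leavitt_involution.
exact: anti_involution_artinian hK.
Qed.

End LeavittRelations.

(** * Finite acyclic ultragraphs *)

Lemma set_seq_cons (T : eqType) (x : T) (s : seq T) :
  [set` x :: s] = x |` [set` s].
Proof.
apply/seteqP; split=> y /=; rewrite inE.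
  by case/predU1P; [left|right].
by case=> [->|->]; rewrite ?eqxx ?orbT.
Qed.

Section FiniteAcyclic.
Variables (R : fieldType) (G : ultragraph).
Notation L := (leavitt R G).
Notation lS := (lS R).
Notation lSstar := (lSstar R).
Notation lP := (lP R).
Implicit Types (A B : set (vertex G)) (v w : vertex G) (e f : edge G).

Definition sink v := forall e, usource e <> v.

Lemma lP_vertex A v :
  gen_vertex A -> lP A ** lP [set v] = if v \in A then lP [set v] else 0.
Proof.
move=> gA; rewrite lPM //; last exact: gv_vertex.
case: ifPn => [/set_mem Av|/negP nAv].
  by congr lP; apply/setIidPr => _ ->.
rewrite -(lP0 R G); congr lP; apply/seteqP; split=> // w [Aw /= wv].
by apply: nAv; rewrite -wv; exact: mem_set.
Qed.

Lemma lP_edge A e :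
  gen_vertex A -> lP A ** lS e = if usource e \in A then lS e else 0.
Proof.
move=> gA; rewrite -lsourceS numulA lP_vertex //.
by case: ifP => // _; rewrite num0ul.
Qed.

Lemma lSstar_vertex e v : usource e <> v -> lSstar e ** lP [set v] = 0.
Proof.
move=> ev; rewrite -lSstarsource -numulA lP_vertex; last exact: gv_vertex.
by case: ifP => [/set_mem /esym|]; rewrite ?numul0.
Qed.

Lemma gen_vertex_seq (s : seq (vertex G)) : s != [::] -> gen_vertex [set` s].
Proof.
elim: s => // v [_ _|w s IHs _]; first by rewrite set_cons1; exact: gv_vertex.
by rewrite set_seq_cons; apply: gv_union; [exact: gv_vertex|exact: IHs].
Qed.

Section FiniteEdges.
Variable es : seq (edge G).
Hypotheses (ues : uniq es) (esT : forall e, e \in es).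

Section Sink.
Variable v : vertex G.
Hypothesis sv : sink v.

(** The left ideal L p_v is spanned by the products of a path and p_v; this is
    the same span, described by splitting off the first edge of the paths. The
    normalization p_r(e) x_e = x_e makes x_e equal to s_e^* x. *)
Inductive path_span : L -> Prop :=
| path_span0 : path_span 0
| path_spanS c (x : edge G -> L) : (forall e, path_span (x e)) ->
    (forall e, lP (@urange G e) ** x e = x e) ->
    path_span (c *: lP [set v] + \sum_(e <- es) lS e ** x e).

Lemma path_spanD x y : path_span x -> path_span y -> path_span (x + y).
Proof.
move=> px; elim: px y => [|c {}x px IHx rx] y; first by rewrite add0r.
case=> [|d {}y py ry]; first by rewrite addr0; exact: path_spanS.
rewrite addrACA -scalerDl -big_split /=.
rewrite (eq_bigr (fun e => lS e ** (x e + y e))) => [|e _].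
  by apply: path_spanS => e; [exact: IHx|rewrite numulDr rx ry].
by rewrite numulDr.
Qed.

Lemma path_spanZ k x : path_span x -> path_span (k *: x).
Proof.
elim=> [|c {}x px IHx rx]; first by rewrite scaler0; exact: path_span0.
rewrite scalerDr scalerA scaler_sumr.
rewrite (eq_bigr (fun e => lS e ** (k *: x e))) => [|e _].
  by apply: path_spanS => // e; rewrite -nuscalerAr rx.
by rewrite nuscalerAr.
Qed.

Lemma path_span_vertex : path_span (lP [set v]).
Proof.
rewrite -[lP _]scale1r -[_ *: _]addr0.
rewrite (_ : 0 = \sum_(e <- es) lS e ** 0); last first.
  by rewrite big1 // => e _; rewrite numul0.
by apply: path_spanS => e; [exact: path_span0|rewrite numul0].
Qed.

Let path_span_lS_range e x :
  path_span x -> lP (@urange G e) ** x = x -> path_span (lS e ** x).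
Proof.
move=> px rx; pose y f := if f == e then x else 0.
have -> : lS e ** x = 0 *: lP [set v] + \sum_(f <- es) lS f ** y f.
  rewrite scale0r add0r (bigD1_seq e) //= /y eqxx big1 ?addr0 // => f /negPf->.
  by rewrite numul0.
apply: path_spanS => f; rewrite /y; case: eqP => [fe|_] //.
- exact: path_span0.
- by rewrite fe.
- by rewrite numul0.
Qed.

Lemma path_span_lP A x : gen_vertex A -> path_span x -> path_span (lP A ** x).
Proof.
move=> gA [|c {}x px rx]; first by rewrite numul0; exact: path_span0.
rewrite numulDr -nuscalerAr numul_sumr lP_vertex //.
apply: path_spanD.
  case: ifP => _; first exact/path_spanZ/path_span_vertex.
  by rewrite scaler0; exact: path_span0.
elim/big_ind: _ => [||e _]; first exact: path_span0.
  exact: path_spanD.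
rewrite numulA lP_edge //; case: ifP => _; first exact: path_span_lS_range.
by rewrite num0ul; exact: path_span0.
Qed.

Lemma path_span_lS e x : path_span x -> path_span (lS e ** x).
Proof.
move=> px; have gr := gv_range e; rewrite -lSrange -numulA.
apply: path_span_lS_range; first exact: path_span_lP.
by rewrite numulA lPM // setIid.
Qed.

Lemma lSstar_path_sum e c (x : edge G -> L) :
  lSstar e ** (c *: lP [set v] + \sum_(f <- es) lS f ** x f) =
  lP (@urange G e) ** x e.
Proof.
rewrite numulDr -nuscalerAr lSstar_vertex ?scaler0 ?add0r; last exact: sv.
rewrite numul_sumr (bigD1_seq e) //= numulA lSstarS eqxx.
rewrite big1 ?addr0 // => f /negPf fe.
by rewrite numulA lSstarS eq_sym fe num0ul.
Qed.

Lemma path_span_lSstar e x : path_span x -> path_span (lSstar e ** x).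
Proof.
move=> [|c {}x px rx]; first by rewrite numul0; exact: path_span0.
by rewrite lSstar_path_sum rx.
Qed.

Lemma path_spanM a x : path_span x -> path_span (a ** x).
Proof.
elim/(@leavitt_closed R G): a x
  => [|a b Pa Pb|k a Pa|a b Pa Pb|e|e|A gA] x px.
- by rewrite num0ul; exact: path_span0.
- by rewrite numulDl; apply: path_spanD; [exact: Pa|exact: Pb].
- by rewrite -nuscalerAl; apply: path_spanZ; exact: Pa.
- by rewrite -numulA; apply/Pa/Pb.
- exact: path_span_lS.
- exact: path_span_lSstar.
- exact: path_span_lP.
Qed.

(** If p_v occurs in x, then p_v x is a nonzero multiple of p_v, as no edge
    leaves the sink v. Otherwise some s_e^* x is nonzero, and it involves
    shorter paths. *)
Lemma path_span_generates x :
  path_span x -> x <> 0 -> exists a, a ** x = lP [set v].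
Proof.
elim=> [//|c {}x px IHx rx].
have [->|c0] := eqVneq c 0; last first.
  move=> _; exists (c^-1 *: lP [set v]).
  have gv := gv_vertex v.
  rewrite -nuscalerAl numulDr -nuscalerAr lP_vertex // mem_set //.
  rewrite numul_sumr big1 => [|e _].
    by rewrite addr0 scalerA mulVf // scale1r.
  by rewrite numulA lP_edge // memNset ?num0ul //=; exact: sv.
move=> sum0.
have [e xe] : exists e, x e <> 0.
  apply: contrapT => noe; apply: sum0; rewrite scale0r add0r big1 // => e _.
  have [->|xe] := pselect (x e = 0); first by rewrite numul0.
  by case: noe; exists e.
have [a axe] := IHx e xe.
by exists (a ** lSstar e); rewrite -numulA lSstar_path_sum rx.
Qed.

(** L p_v is simple or zero, because p_v lies in the left ideal generated by any
    nonzero element of L p_v. *)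
Lemma sink_socle : socle (lP [set v]).
Proof.
have [->|v0] := pselect (lP [set v] = 0).
  exact: left_ideal0 (socle_left_ideal _).
have gv := gv_vertex v.
pose M := [set x | x ** lP [set v] = x].
have Mv : M (lP [set v]) by rewrite /M /= lPM // setIid.
suff sM : simple_left_ideal M by exact: (sub_ideal_sum sM).
have iM : left_ideal M.
  split=> [|x y Mx My|a x Mx]; rewrite /M /=.
  - by rewrite num0ul.
  - by rewrite numulDl numulNl Mx My.
  - by rewrite -numulA Mx.
split=> // [M0|I iI IM]; first by apply: v0; move: Mv; rewrite M0.
have [|I0] := pselect (I = [set 0]); first by left.
right; have [x Ix x0] := left_ideal_neq0 iI I0.
apply/seteqP; split=> // y <-; apply: left_idealM => //.
have [|a <-] := path_span_generates _ x0; last exact: left_idealM.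
by rewrite -(IM _ Ix); apply: path_spanM; exact: path_span_vertex.
Qed.

End Sink.

(** A vertex without P has an outgoing edge whose range contains another one.
    This yields an infinite sequence of edges, in which some edge occurs twice;
    the segment between the two occurrences is a cycle. *)
Lemma acyclic_ind (P : vertex G -> Prop) : acyclic_ultragraph G ->
  (forall v, (forall e w, usource e = v -> urange e w -> P w) -> P v) ->
  forall v, P v.
Proof.
move=> acG Pind v; apply: contrapT => Pv.
pose T := {e | exists2 w, @urange G e w & ~ P w}.
have edgeT u : ~ P u -> exists e : T, usource (sval e) = u.
  move=> Pu; apply: contrapT => noe; apply: Pu; apply: Pind => e w eu ew.
  apply: contrapT => Pw.
  have Te : exists2 w, @urange G e w & ~ P w by exists w.
  by apply: noe; exists (exist _ e Te).
have /choice[next nextP] (e : T) :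
    exists f : T, urange (sval e) (usource (sval f)).
  case: e => e Te; have [w ew Pw] := Te; have [f fw] := edgeT w Pw.
  by exists f; rewrite /= fw.
have [e0 _] := edgeT v Pv.
pose g k := sval (iter k next e0).
have gP k : urange (g k) (usource (g k.+1)) by exact: nextP.
pose r := [rel e f | usource f \in @urange G e].
have pathg n i : path r (g i) [seq g k | k <- iota i.+1 n].
  by elim: n i => //= n IHn i; rewrite mem_set //=; exact: gP.
have : ~~ uniq [seq g k | k <- iota 0 (size es).+1].
  apply/negP => /uniq_leq_size/(_ (fun e _ => esT e)).
  by rewrite size_map size_iota ltnn.
case/(uniqPn (g 0%N)) => i [j] [ij]; rewrite size_map size_iota => js.
have js' := ltn_trans ij js.
rewrite !(nth_map 0%N) ?size_iota // !nth_iota // !add0n => gij.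
pose c := [seq g k | k <- iota i (j - i)].
have c0 : c != [::].
  by rewrite -size_eq0 size_map size_iota -lt0n subn_gt0.
apply: (negP (acG c c0)); rewrite /c.
have -> : (j - i)%N = (j - i).-1.+1 by rewrite prednK // subn_gt0.
rewrite /= -[rcons _ _]/(rcons _ (g i)) gij -cats1.
rewrite (_ : [:: g j] = [seq g k | k <- iota (i.+1 + (j - i).-1) 1]).
  by rewrite -map_cat -iotaD -gij; exact: pathg.
by rewrite /= addSnnS prednK ?subn_gt0 // subnKC // ltnW.
Qed.

Hypothesis finV : finite_set [set: vertex G].

(** p_A is obtained from the p_w by p_(A u B) = p_A + p_B - p_A p_B. *)
Lemma socle_lP A : (forall w, A w -> socle (lP [set w])) -> socle (lP A).
Proof.
have iA := socle_left_ideal L.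
have /finite_seqP[s ->] : finite_set A by apply: sub_finite_set finV.
elim: s => [|v s IHs] sA.
  by rewrite set_nil lP0; exact: left_ideal0.
have sv : socle (lP [set v]) by apply: sA; exact: mem_head.
have [->|s0] := eqVneq s [::]; first by rewrite set_cons1.
have ss : socle (lP [set` s]).
  by apply: IHs => w ws; apply: sA; rewrite /= inE ws orbT.
rewrite set_seq_cons lPU; [|exact: gv_vertex|exact: gen_vertex_seq].
apply: left_idealB => //; first exact: left_idealD.
exact: left_idealM.
Qed.

(** By (CK), p_v is a sum of the s_e p_r(e) s_e^* unless v is a sink, and the
    socle is a two-sided ideal. *)
Lemma socle_vertex v : acyclic_ultragraph G -> socle (lP [set v]).
Proof.
move=> acG; move: v; apply: (acyclic_ind acG) => v IHv.
have iA := socle_left_ideal L.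
have [sv|nsv] := pselect (sink v); first exact: sink_socle.
rewrite (@lCK R G v [seq e <- es | usource e == v]).
- apply: left_ideal_sum => // e; rewrite mem_filter => /andP[/eqP ev _].
  rewrite -lSrange; apply: socle_mulr; apply: left_idealM => //.
  by apply: socle_lP => w ew; exact: IHv ew.
- apply: contra_notN nsv => /eqP es0 e ev.
  have : e \in [seq e <- es | usource e == v] by rewrite mem_filter ev eqxx esT.
  by rewrite es0.
- exact: filter_uniq.
- by move=> e; rewrite mem_filter esT andbT.
Qed.

End FiniteEdges.

Lemma gen_vertexT v : finite_set [set: vertex G] -> gen_vertex [set: vertex G].
Proof.
move/finite_seqP=> [s sT]; rewrite sT; apply: gen_vertex_seq.
by apply/eqP => s0; have : [set: vertex G] v by []; rewrite sT s0.
Qed.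

Lemma lPT_unit : finite_set [set: vertex G] ->
  forall x : L, lP setT ** x = x /\ x ** lP setT = x.
Proof.
move=> finV.
apply: leavitt_closed => [|x y [ux xu] [uy yu]|k x [ux xu]
    |x y [ux xu] [uy yu]|e|e|A gA].
- by rewrite num0ul numul0.
- by rewrite numulDl numulDr ux uy xu yu.
- by rewrite -nuscalerAl -nuscalerAr ux xu.
- by rewrite numulA ux -numulA yu.
- have gT := gen_vertexT (usource e) finV; have gr := gv_range e.
  by rewrite lP_edge // in_setT -lSrange -numulA lPM // setIT.
- have gT := gen_vertexT (usource e) finV; have gv := gv_vertex (usource e).
  have gr := gv_range e; split.
    by rewrite -lrangeSstar numulA lPM // setTI.
  by rewrite -lSstarsource -numulA lPM // setIT.
- have [v _] := gen_vertex_neq0 gA; have gT := gen_vertexT v finV.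
  by rewrite !lPM // setTI setIT.
Qed.

Lemma finite_acyclic_unital_semisimple :
  finite_ultragraph G -> acyclic_ultragraph G -> unital_semisimple L.
Proof.
move=> [finV finE] acG; apply/unital_semisimpleE.
have u1 := lPT_unit finV; split; first by exists (lP setT).
apply/seteqP; split=> // x _; rewrite -(u1 x).2.
apply: left_idealM; first exact: socle_left_ideal.
have /finite_seqP[s sT] := finE.
apply: (@socle_lP) => // v _; apply: (@socle_vertex (undup s)) => // [|e].
  exact: undup_uniq.
by rewrite mem_undup; have : [set: edge G] e by []; rewrite sT.
Qed.

End FiniteAcyclic.

(** * Modules over presented algebras *)

Section Action.
Variables (R : comPzRingType) (X : Type) (W : lmodType R) (op : X -> W -> W).
Hypothesis op_linear : forall x, linear (op x).

Fixpoint tact (t : term R X) (w : W) : W :=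
  match t with
  | TVar x => op x w
  | TZero => 0
  | TOpp t => - tact t w
  | TAdd t u => tact t w + tact u w
  | TScale k t => k *: tact t w
  | TMul t u => tact t (tact u w)
  end.

Lemma tact_linear t : linear (tact t).
Proof.
elim: t => /= [x||t IHt|t IHt u IHu|l t IHt|t IHt u IHu] k v w.
- exact: op_linear.
- by rewrite scaler0 addr0.
- by rewrite IHt opprD scalerN.
- by rewrite IHt IHu scalerDr addrACA.
- by rewrite IHt scalerDr !scalerA mulrC.
- by rewrite IHu IHt.
Qed.

Lemma tactD t v w : tact t (v + w) = tact t v + tact t w.
Proof. by have := tact_linear t 1 v w; rewrite !scale1r. Qed.

Lemma tact0 t : tact t 0 = 0.
Proof. by apply: (addrI (tact t 0)); rewrite -tactD !addr0. Qed.

Lemma tactZ t k w : tact t (k *: w) = k *: tact t w.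
Proof. by have := tact_linear t k w 0; rewrite tact0 !addr0. Qed.

Lemma tact_tsum (s : seq (term R X)) w :
  tact (tsum s) w = \sum_(t <- s) tact t w.
Proof. by elim: s => [|t s /= ->]; rewrite ?big_nil ?big_cons. Qed.

Variable rels : term R X -> term R X -> Prop.
Hypothesis op_rels : forall t u, rels t u -> tact t =1 tact u.

Lemma tcongr_tact t u : tcongr rels t u -> tact t =1 tact u.
Proof.
elim=> {t u} /=.
- exact: op_rels.
- by [].
- by move=> t u _ tu w; rewrite tu.
- by move=> t u v _ tu _ uv w; rewrite tu.
- by move=> t u _ tu w; rewrite tu.
- by move=> t u t' u' _ tu _ tu' w; rewrite tu tu'.
- by move=> k t u _ tu w; rewrite tu.
- by move=> t u t' u' _ tu _ tu' w; rewrite tu' tu.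
- by move=> t u v w; rewrite addrA.
- by move=> t u w; rewrite addrC.
- by move=> t w; rewrite add0r.
- by move=> t w; rewrite addNr.
- by move=> k l t w; rewrite scalerA.
- by move=> t w; rewrite scale1r.
- by move=> k t u w; rewrite scalerDr.
- by move=> k l t w; rewrite scalerDl.
- by [].
- by [].
- by move=> t u v w; rewrite tactD.
- by [].
- by move=> k t u w; rewrite tactZ.
Qed.

(** The annihilators of {w 0, ..., w (n - 1)} form a strictly descending chain
    of left ideals, the class of t n being in the n-th one, but not in the
    next. *)
Lemma not_left_artinian (w : nat -> W) (t : nat -> term R X) :
  (forall n i, (i < n)%N -> tact (t n) (w i) = 0) ->
  (forall n, tact (t n) (w n) <> 0) ->
  ~ left_artinian (presented rels).
Proof.
move=> tw0 twn artA.
pose act (x : presented rels) := tact (prepr x).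
have actE u : act (pclass rels u) =1 tact u by exact/tcongr_tact/prepr_congr.
pose I n : set (presented rels) :=
  [set x | forall i, (i < n)%N -> act x (w i) = 0].
have [||N IN] := artA I.
- move=> n; split=> [i _|x y Ix Iy i lin|a x Ix i lin].
  + by rewrite actE.
  + move: (Ix _ lin) (Iy _ lin).
    elim/presented_ind: x {Ix} => x; elim/presented_ind: y {Iy} => y.
    by rewrite pclassN pclassD !actE /= => -> ->; rewrite subr0.
  + move: (Ix _ lin); elim/presented_ind: x {Ix} => x.
    elim/presented_ind: a => a.
    by rewrite pclassM !actE /= => ->; rewrite tact0.
- by move=> n x Ix i lin; apply: Ix; rewrite leqW.
have tN : I N (pclass rels (t N)) by move=> i lin; rewrite actE tw0.
move: tN; rewrite -(IN N.+1) // => /(_ N (leqnn _)).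
by rewrite actE; exact: twn.
Qed.

End Action.

Lemma infinite_sequence (T : Type) :
  infinite_set [set: T] -> exists f : nat -> T, injective f.
Proof.
move/infiniteP/card_leP => [f].
exists (fun n => set_val (f (SigSub (mem_set (I : [set: nat] n))))).
move=> m n /val_inj.
by move=> /(@inj _ _ _ f); rewrite !in_setT => /(_ isT isT) [].
Qed.

(** * The module of functions on maximal paths *)

Section PathModule.
Variables (R : fieldType) (G : ultragraph).

(** A maximal path is encoded as an infinite sequence, in which [inr e] is the
    passage of an edge and [inl v] marks that the path has ended at the sink v;
    nothing relates [inl v] to the next step. No path ends at an infinite
    emitter. *)
Definition step : Type := (vertex G + edge G)%type.

Definition step_source (a : step) : vertex G :=
  match a with inl v => v | inr e => usource e end.

Definition step_to (a b : step) : Prop :=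
  match a with
  | inl v => sink v
  | inr e => urange e (step_source b)
  end.

Implicit Types (y : nat -> step) (A : set (vertex G)) (v : vertex G)
  (e f : edge G).

Definition maximal_path y : Prop := forall n, step_to (y n) (y n.+1).

Definition pshift y : nat -> step := fun n => y n.+1.

Definition pcons e y : nat -> step := fun n => if n is k.+1 then y k else inr e.

Definition path_from A y : Prop := maximal_path y /\ A (step_source (y 0%N)).

Definition starts_with e y : Prop := maximal_path y /\ y 0%N = inr e.

Lemma pcons_shift e y : y 0%N = inr e -> pcons e (pshift y) = y.
Proof. by move=> ye; apply/funext => -[|n] //=; rewrite ye. Qed.

Lemma starts_with_cons e f y :
  path_from (@urange G e) y -> starts_with f (pcons e y) <-> e = f.
Proof.
case=> my ey; split=> [[_ [->]]//|<-]; split=> // -[|n]; last exact: my.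
exact: ey.
Qed.

Lemma starts_withE e y :
  starts_with e y <-> y 0%N = inr e /\ path_from (@urange G e) (pshift y).
Proof.
split=> [[my ye]|[ye [my ey]]].
  by split=> //; split=> [n|]; [exact: my|move: (my 0%N); rewrite ye].
by split=> // -[|n]; [rewrite ye|exact: my].
Qed.

(** s_e shifts the integer by 1, so that a cycle acts on the functions supported
    at its periodic path as a translation of Z; without the integer it would fix
    them. *)
Definition pmod : Type := ((nat -> step) * int)%type -> R^o.

HB.instance Definition _ := GRing.Lmodule.on pmod.

Lemma pmodE : (forall (phi psi : pmod) p, (phi + psi) p = phi p + psi p) *
  (forall (phi : pmod) p, (- phi) p = - phi p) *
  (forall k (phi : pmod) p, (k *: phi) p = k * phi p) *
  (forall p, (0 : pmod) p = 0).
Proof. by []. Qed.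

Lemma pmod_sum (I : Type) (s : seq I) (phi : I -> pmod) p :
  (\sum_(i <- s) phi i) p = \sum_(i <- s) phi i p.
Proof. by elim/big_rec2: _ => // i x y _ <-. Qed.

Definition opP A (phi : pmod) : pmod :=
  fun p => if `[< path_from A p.1 >] then phi p else 0.

Definition opS e (phi : pmod) : pmod :=
  fun p => if `[< starts_with e p.1 >] then phi (pshift p.1, p.2 + 1) else 0.

Definition opSstar e (phi : pmod) : pmod :=
  fun p => if `[< path_from (@urange G e) p.1 >] then phi (pcons e p.1, p.2 - 1)
           else 0.

Definition leavitt_op (g : leavitt_gen G) : pmod -> pmod :=
  match g with
  | GenS e => opS e
  | GenSstar e => opSstar e
  | @GenP _ A _ => opP A
  end.

Lemma leavitt_op_linear g : linear (leavitt_op g).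
Proof.
case: g => [e|e|A gA] k phi psi; apply/funext => p; rewrite !pmodE /=;
  rewrite /opP /opS /opSstar; case: asboolP => _; rewrite ?pmodE //.
all: by rewrite mulr0 addr0.
Qed.

Notation act := (@tact R _ pmod leavitt_op).

Lemma path_fromE A y : `[< path_from A y >] =
  `[< maximal_path y >] && (step_source (y 0%N) \in A).
Proof.
by rewrite asbool_and; congr (_ && _); apply/asboolP/idP => /set_mem.
Qed.

Lemma act_tP A phi : act (tP R A) phi = opP A phi \/ A !=set0 /\ ~ gen_vertex A.
Proof.
rewrite /tP; case: pselect => [gA|nA] /=; first by left.
have [A0|] := pselect (A !=set0); first by right.
move=> A0; left; apply/funext => p; rewrite /opP; case: asboolP => // -[_ Ap].
by case: A0; exists (step_source (p.1 0%N)).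
Qed.

Lemma act_gen A phi : gen_vertex A -> act (tP R A) phi = opP A phi.
Proof. by move=> gA; case: (act_tP A phi) => // -[_]. Qed.

Lemma act_setI A B phi : gen_vertex A -> gen_vertex B ->
  act (tP R (A `&` B)) phi = opP (A `&` B) phi.
Proof.
move=> gA gB; case: (act_tP (A `&` B) phi) => // -[AB0] [].
exact: gv_inter.
Qed.

Lemma opS_opSstar e phi y i : opS e (opSstar e phi) (y, i) =
  if `[< starts_with e y >] then phi (y, i) else 0.
Proof.
rewrite /opS /opSstar /=; case: asboolP => // /starts_withE[ye py].
by rewrite asboolT // pcons_shift // addrK.
Qed.

(** A maximal path starting at v starts with exactly one edge leaving v, unless
    v is a sink; this gives (CK). *)
Lemma leavitt_op_rels t u : leavitt_rel t u -> act t =1 act u.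
Proof.
case=> {t u} [A B gA gB|A B gA gB|e|e|e|e|e f|v es es0 ues esE] phi;
  apply/funext => -[y i] /=.
- rewrite (act_gen _ gA) (act_gen _ gB) act_setI // /opP /= !path_fromE in_setI.
  by case: asboolP => //=; case: (_ \in A); case: (_ \in B).
- rewrite !pmodE /= (act_gen _ gA) (act_gen _ gB) act_setI //.
  rewrite act_gen; last exact: gv_union.
  rewrite /opP /= !path_fromE in_setI in_setU.
  case: asboolP => //= _; last by rewrite addr0 subr0.
  by case: (_ \in A); case: (_ \in B); rewrite /= ?addrK ?subr0 ?add0r.
- rewrite act_gen; last exact: gv_vertex.
  rewrite /opP /opS /=; case: asboolP => // nP; case: asboolP => // -[my ye].
  by case: nP; split; rewrite // ye.
- rewrite act_gen; last exact: gv_range.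
  rewrite /opP /opS /=; case: asboolP => // /starts_withE[_ py].
  by case: asboolP.
- rewrite act_gen; last exact: gv_range.
  by rewrite /opP /opSstar /=; case: asboolP.
- rewrite act_gen; last exact: gv_vertex.
  rewrite /opP /opSstar /=; case: asboolP => // py; case: asboolP => // -[].
  by have [_ +] := starts_with_cons e py => /(_ erefl) -[].
- have -> : act (if e == f then tP R (@urange G e) else TZero) phi =
    if e == f then opP (@urange G e) phi else 0.
    by case: ifP => _; rewrite // act_gen //; exact: gv_range.
  rewrite /opSstar /opS /opP /=; case: (asboolP (path_from _ y)) => py.
    have swE := starts_with_cons f py.
    case: asboolP => [/swE ef|nef].
      by rewrite -ef eqxx /= asboolT // subrK.
    by case: eqP => // /swE.
  by case: eqP => // _; rewrite /= asboolF.
- rewrite act_gen; last exact: gv_vertex.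
  rewrite (@tact_tsum _ _ pmod) big_map pmod_sum /opP /=.
  rewrite (eq_bigr _ (fun e _ => opS_opSstar e phi y i)).
  case: asboolP => [[my yv]|nyv]; last first.
    rewrite big_seq big1 // => e; rewrite esE => /eqP ev.
    by case: asboolP => // -[my ye]; case: nyv; split; rewrite // ye.
  case ye : (y 0%N) => [u|e].
    case: es es0 esE {ues} => // e es _ esE.
    have := esE e; rewrite mem_head => /esym/eqP ev.
    move: (my 0%N) yv; rewrite ye /= => su uv.
    by case: (su e); rewrite ev uv.
  have ees : e \in es by rewrite esE; move: yv; rewrite ye => /= ->.
  rewrite (bigD1_seq e) //= asboolT // big1 ?addr0 // => f /eqP fe.
  by case: asboolP => // -[_]; rewrite ye => -[ef]; case: fe.
Qed.

Lemma exists_path A : A !=set0 -> exists y, path_from A y.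
Proof.
case=> v Av; pose ok (a : step) := if a is inl v then sink v else True.
have start u : exists a, step_source a = u /\ ok a.
  have [su|nsu] := pselect (sink u); first by exists (inl u).
  by have /existsNP[e /contrapT eu] := nsu; exists (inr e).
have /choice[nxt nxtP] a : exists b, ok a -> ok b /\ step_to a b.
  case: a => [u|e]; first by exists (inl u).
  have [w ew] := urange_neq0 e; have [b [bw okb]] := start w.
  by exists b; split; rewrite //= bw.
have [a [av oka]] := start v.
have okn n : ok (iter n nxt a) by elim: n => //= n /nxtP[].
exists (fun n => iter n nxt a); split; last by rewrite /= av.
by move=> n; have [_] := nxtP _ (okn n).
Qed.

Definition delta y (g : int -> R) : pmod :=
  fun p => if p.1 == y then g p.2 else 0.

Lemma delta_neq0 y : delta y (fun=> 1) <> 0.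
Proof.
move=> /(congr1 (fun phi : pmod => phi (y, 0))).
by rewrite /delta /= eqxx pmodE; apply/eqP; exact: oner_neq0.
Qed.

Lemma opP_delta A y g :
  opP A (delta y g) = if `[< path_from A y >] then delta y g else 0.
Proof.
apply/funext => -[y' i]; rewrite /opP /delta /=.
have [->|yy] := eqVneq y' y; first by case: asboolP => _; rewrite ?eqxx.
by case: asboolP => _; case: asboolP => _; rewrite ?(negPf yy).
Qed.

Lemma opS_delta e y g : path_from (@urange G e) y ->
  opS e (delta y g) = delta (pcons e y) (fun i => g (i + 1)).
Proof.
move=> py; apply/funext => -[y' i]; rewrite /opS /delta /=.
have [->|yy] := eqVneq y' (pcons e y).
  by rewrite eqxx asboolT //; apply/starts_with_cons.
case: asboolP => // -[_ ye]; case: eqP => // yE; case/eqP: yy.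
by rewrite -yE pcons_shift.
Qed.

Lemma vertex_finite : left_artinian (leavitt R G) -> finite_set [set: vertex G].
Proof.
move=> artL; apply: contrapT => /infinite_sequence[v v_inj].
have /choice[y py] n : exists y, path_from [set v n] y.
  by apply: exists_path; exists (v n).
apply: (not_left_artinian leavitt_op_linear leavitt_op_rels
  (w := fun n => delta (y n) (fun=> 1))
  (t := fun n => tP R [set v n]) _ _ artL).
- move=> n i lin; rewrite act_gen; last exact: gv_vertex.
  rewrite opP_delta asboolF // => -[_]; have [_ ->] := py i.
  by move=> /v_inj ni; rewrite ni ltnn in lin.
- move=> n; rewrite act_gen; last exact: gv_vertex.
  rewrite opP_delta asboolT //; exact: delta_neq0.
Qed.

Lemma edge_finite : left_artinian (leavitt R G) -> finite_set [set: edge G].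
Proof.
move=> artL; apply: contrapT => /infinite_sequence[e e_inj].
have /choice[y py] n : exists y, path_from (@urange G (e n)) y.
  by apply: exists_path; exact: urange_neq0.
apply: (not_left_artinian leavitt_op_linear leavitt_op_rels
  (w := fun n => opS (e n) (delta (y n) (fun=> 1)))
  (t := fun n => tSstar R (e n)) _ _ artL) => [n i lin|n].
- rewrite -[LHS]/(act (TMul (tSstar R (e n)) (tS R (e i))) _).
  rewrite (leavitt_op_rels (lr_SstarS _ _ _)) ifN //=.
  by apply/eqP => /e_inj ni; rewrite ni ltnn in lin.
- rewrite -[X in X <> _]/(act (TMul (tSstar R (e n)) (tS R (e n))) _).
  rewrite (leavitt_op_rels (lr_SstarS _ _ _)) eqxx.
  rewrite act_gen; last exact: gv_range.
  by rewrite opP_delta asboolT //; exact: delta_neq0.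
Qed.

(** The primitive for step 1 is a signed sum between 0 and i; for step n one
    works in each residue class modulo n. *)
Lemma int_difference (n : nat) (g : int -> R) : (0 < n)%N ->
  exists h : int -> R, forall i, h (i + n%:Z) - h i = g i.
Proof.
have H (f : int -> R) : exists h : int -> R, forall i, h (i + 1) - h i = f i.
  exists (fun i => match i with
    | Posz m => \sum_(0 <= k < m) f (Posz k)
    | Negz m => - \sum_(0 <= k < m.+1) f (Negz k)
    end) => -[m|[|m]].
  - by rewrite -PoszD addn1 big_nat_recr //= addrAC subrr add0r.
  - by rewrite NegzE addNr /= big_geq // big_nat1 opprK add0r.
  - rewrite (_ : Negz m.+1 + 1 = Negz m); last first.
      by rewrite !NegzE -addn1 PoszD opprD addrK.
    by rewrite opprK [X in _ + X]big_nat_recr //= addKr.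
move=> n0; have /choice[h hP] r := H (fun j => g (j * n%:Z + r)).
exists (fun i => h (i %% n)%Z (i %/ n)%Z) => i.
rewrite modzDr -[X in (X %/ _)%Z]addrC -[X in (X + i)%R]mul1r.
by rewrite divzMDl -?lt0n ?eqz_nat // [1 + _]addrC hP -divz_eq.
Qed.

Lemma cycle_unroll (c : seq (edge G)) :
  c != [::] -> cycle [rel e f | usource f \in @urange G e] c ->
  exists2 d : nat -> edge G, forall i, urange (d i) (usource (d i.+1)) &
    forall i, d (size c + i)%N = d i.
Proof.
case: c => // e c _ /= /(pathP e) pc.
exists (fun i => nth e (e :: c) (i %% (size c).+1)) => i; last first.
  by rewrite modnDl.
have := pc (i %% (size c).+1)%N.
rewrite size_rcons ltn_pmod // => /(_ isT) /set_mem.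
set j := (i %% _)%N; have j_lt : (j < (size c).+1)%N by exact: ltn_pmod.
have -> : (i.+1 %% (size c).+1)%N = (j.+1 %% (size c).+1)%N.
  by rewrite -addn1 -modnDml addn1.
rewrite -rcons_cons nth_rcons j_lt nth_rcons /=.
move: j_lt; rewrite ltnS leq_eqVlt => /predU1P[->|jc].
  by rewrite ltnn eqxx modnn.
by rewrite jc modn_small.
Qed.

(** The vectors are the functions g k on Z, placed at the periodic path y 0 with
    edges d; the difference operator g |-> g (. + n) - g sends g (k + 1) to g k,
    and g 0 = 1 to 0. *)
Lemma left_artinian_acyclic :
  left_artinian (leavitt R G) -> acyclic_ultragraph G.
Proof.
move=> artL c c0; apply/negP => /(cycle_unroll c0)[d dr dc].
pose y k : nat -> step := fun i => inr (d (k + i)%N).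
have yE k : pcons (d k) (y k.+1) = y k.
  by apply/funext => -[|i]; rewrite /y /= ?addn0 ?addnS.
have py k : path_from (@urange G (d k)) (y k.+1).
  split=> [i|]; rewrite /y /= ?addnS ?addn0 ?addSn; exact: dr.
have yn : y (size c) = y 0%N by apply/funext => i; rewrite /y dc.
pose p := tP R [set usource (d 0%N)].
have pE g : act p (delta (y 0%N) g) = delta (y 0%N) g.
  rewrite act_gen; last exact: gv_vertex.
  rewrite opP_delta asboolT //; by split=> // i; exact: dr.
(* T k is the product s_(d 0) ... s_(d (k - 1)), started from p_v. *)
pose T := fix T k := if k is k.+1 then TMul (T k) (tS R (d k)) else p.
have TE k g : act (T k) (delta (y k) g) = delta (y 0%N) (fun i => g (i + k%:Z)).
  elim: k g => [|k IHk] g /=.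
    by rewrite pE; congr delta; apply/funext => i; rewrite addr0.
  rewrite opS_delta // yE IHk; congr delta; apply/funext => i.
  by rewrite -addrA -PoszD addn1.
pose z := TAdd (T (size c)) (TOpp p).
have zE g : act z (delta (y 0%N) g) =
    delta (y 0%N) (fun i => g (i + (size c)%:Z) - g i).
  rewrite /= -{1}yn TE pE; apply/funext => -[y' i].
  by rewrite !pmodE /delta /=; case: eqP => _ //; rewrite subr0.
have [g g0 gS] : exists2 g : nat -> int -> R, g 0%N = (fun=> 1) &
    forall k i, g k.+1 (i + (size c)%:Z) - g k.+1 i = g k i.
  have c_gt0 : (0 < size c)%N by case: (c) c0.
  have /choice[h hP] (g : int -> R) := int_difference g c_gt0.
  by exists (fun k => iter k h (fun=> 1)) => // k i; exact: hP.
pose Z := fix Z k := if k is k.+1 then TMul (Z k) z else p.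
have ZE k j : act (Z k) (delta (y 0%N) (g j)) =
    if (k <= j)%N then delta (y 0%N) (g (j - k)%N) else 0.
  elim: k j => [|k IHk] j; first by rewrite pE subn0.
  rewrite [LHS](_ : _ = act (Z k) (act z (delta (y 0%N) (g j)))) // zE.
  case: j => [|j].
    rewrite (_ : delta _ _ = 0) ?(@tact0 _ _ pmod) //.
      exact: leavitt_op_linear.
    by apply/funext => -[y' i]; rewrite g0 subrr /delta; case: ifP.
  rewrite (_ : (fun i => _) = g j) ?IHk //.
  by apply/funext => i; exact: gS.
apply: (not_left_artinian leavitt_op_linear leavitt_op_rels
  (w := fun k => delta (y 0%N) (g k)) (t := Z) _ _ artL) => [n i lin|n].
- by rewrite ZE leqNgt lin.
- by rewrite ZE leqnn subnn g0; exact: delta_neq0.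
Qed.

End PathModule.

(** * The equivalences *)

Theorem theorem5p2 (R : fieldType) (G : ultragraph) :
  [<-> finite_ultragraph G /\ acyclic_ultragraph G;
       left_artinian (leavitt R G);
       right_artinian (leavitt R G);
       artinian (leavitt R G);
       unital_semisimple (leavitt R G)].
Proof.
have i_v : finite_ultragraph G /\ acyclic_ultragraph G ->
    unital_semisimple (leavitt R G).
  by case; exact: finite_acyclic_unital_semisimple.
have v_ii := @unital_semisimple_left_artinian (leavitt R G).
have ii_i : left_artinian (leavitt R G) ->
    finite_ultragraph G /\ acyclic_ultragraph G.
  move=> artL; split; last exact: left_artinian_acyclic artL.
  by split; [exact: vertex_finite artL|exact: edge_finite artL].
have ii_iii := leavitt_left_right_artinian R G.
tfae.
- by move/i_v/v_ii.
- by move/ii_iii.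
- by move=> artL; split=> //; exact/ii_iii.
- by case=> /ii_i/i_v.
- by move/v_ii/ii_i.
Qed.
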